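(* Let $K$ be a field, $R=K[x_1,\dots,x_n]$, and let $I\subseteq R$ be a monomial ideal generated in degree $d$. Suppose that $I$ contains $n-3$ pure powers of the variables, say $x_1^d,\dots,x_{n-3}^d$. Then $I$ is a polymatroidal ideal if and only if $I(\mathfrak p)$ has a linear resolution for every monomial prime ideal $\mathfrak p\in\mathcal P(R)$.
   Context: For a monomial ideal $I$, $G(I)$ denotes its unique minimal set of monomial generators; $I$ is generated in degree $d$ if $G(I)$ is nonempty and all elements of $G(I)$ have degree $d$. A monomial ideal $I$ is polymatroidal if it is generated in a single degree and for all $u,v\in G(I)$ and every $i$ with $\deg_{x_i}(u)>\deg_{x_i}(v)$ there exists $j$ such that $\deg_{x_j}(v)>\deg_{x_j}(u)$ and $x_j(u/x_i)\in I$. $\mathcal P(R)$ is the set of monomial prime ideals of $R$, i.e. the ideals generated by subsets of $\{x_1,\dots,x_n\}$. For $\mathfrak p\in\mathcal P(R)$, $R(\mathfrak p)$ is the polynomial ring over $K$ in the variables belonging to $\mathfrak p$, and the monomial localization $I(\mathfrak p)\subseteq R(\mathfrak p)$ is the monomial ideal obtained from $I$ by substituting $1$ for every variable $x_i\notin\mathfrak p$; equivalently its extension to $R$ is $I:(\prod_{x_i\notin\mathfrak p}x_i)^\infty$. A monomial ideal has a linear resolution if it is generated in a single degree $e$ and its minimal graded free resolution is $e$-linear, i.e. its Castelnuovo-Mumford regularity equals $e$; the unit ideal (which arises as $I(\mathfrak p)$ when $I\not\subseteq\mathfrak p$) has a linear resolution, with $e=0$. *)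

(* Defs.v *)
From HB Require Import structures.
From Stdlib Require Classical_Prop.
From mathcomp Require Import all_boot all_order all_algebra.
From mathcomp.multinomials Require Import mpoly.

Set Implicit Arguments.
Unset Strict Implicit.
Unset Printing Implicit Defensive.

Import GRing.Theory.
Local Open Scope ring_scope.

(* Ideals are Prop-valued predicates: the unit ideal must be allowed, and
   membership need not come with a decision procedure. *)
Definition is_ideal (A : nzRingType) (I : A -> Prop) : Prop :=
  [/\ I 0, (forall p q, I p -> I q -> I (p + q))
    & (forall a p, I p -> I (a * p))].

Section MonomialIdeals.

Variables (K : fieldType) (n : nat).
Implicit Types (S : 'X_{1..n} -> Prop) (I : {mpoly K[n]} -> Prop).

(* The smallest ideal containing the monomials with exponents in S. *)
Definition ideal_of_monomials S (p : {mpoly K[n]}) : Prop :=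
  forall J : {mpoly K[n]} -> Prop,
    is_ideal J -> (forall m, S m -> J 'X_[m]) -> J p.

Definition monomially_generates S I : Prop :=
  forall p, I p <-> ideal_of_monomials S p.

Definition monomial_ideal I : Prop := exists S, monomially_generates S I.

(* G(I), as a set of exponents: the monomials of I that are minimal for
   divisibility. By [mingens_generates] and [mingens_least] below this is the
   least set of monomials generating I. *)
Definition mingens I (u : 'X_{1..n}) : Prop :=
  I 'X_[u] /\ forall v : 'X_{1..n}, I 'X_[v] -> (v <= u)%MM -> v = u.

Definition generated_in_degree I (d : nat) : Prop :=
  (exists u, mingens I u) /\ (forall u, mingens I u -> mdeg u = d).

(* The subtraction of exponents is exact below, since v i < u i. *)
Definition polymatroidal I : Prop :=
  [/\ monomial_ideal I,
      exists d, generated_in_degree I d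
    & forall u v : 'X_{1..n}, mingens I u -> mingens I v ->
      forall i : 'I_n, (v i < u i)%N ->
      exists j : 'I_n, (u j < v j)%N /\ I 'X_[(u - U_(i)) + U_(j)] ].

End MonomialIdeals.

Section Localization.

Variables (K : fieldType) (n : nat).

(* A monomial prime is given by the set P of the indices of its variables, and
   R(P) is {mpoly K[#|P|]}, whose k-th variable stands for x_(enum_val k). *)
Definition localize_var (P : {set 'I_n}) (i : 'I_n) : {mpoly K[#|P|]} :=
  if [pick k : 'I_#|P| | enum_val k == i] is Some k then 'X_k else 1.

Definition localize_subst (P : {set 'I_n}) (p : {mpoly K[n]}) :
    {mpoly K[#|P|]} :=
  p \mPo [tuple localize_var P i | i < n].

(* The substitution is onto, so that the image of an ideal is an ideal. *)
Definition localize (P : {set 'I_n}) (I : {mpoly K[n]} -> Prop)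
    (q : {mpoly K[#|P|]}) : Prop :=
  exists2 p, I p & q = localize_subst P p.

End Localization.

Arguments localize {K n} P I q.

Section Resolutions.

Variables (K : fieldType) (n : nat).
Local Notation A := {mpoly K[n]}.

(* Graded free modules F_i = \bigoplus_(k < rk i) A(- sh i k), elements being
   row vectors, with homogeneous maps of degree 0: F_0 -> A, given by aug, and
   F_(i+1) -> F_i, given by dif i, both acting by right multiplication. The
   homogeneity conditions force an entry to vanish if the degree it should
   have is negative. *)
Record graded_free_system := GradedFreeSystem {
  rk : nat -> nat;
  sh : forall i, 'I_(rk i) -> nat;
  aug : 'M[A]_(rk 0, 1);
  dif : forall i, 'M[A]_(rk i.+1, rk i);
  aug_homog : forall k (m : 'X_{1..n}),
    m \in msupp (aug k 0) -> mdeg m = sh k;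
  dif_homog : forall i k l (m : 'X_{1..n}),
    m \in msupp (dif i k l) -> (mdeg m + sh l)%N = sh k
}.

(* ... -> F_1 -> F_0 -> I -> 0 is exact. *)
Definition resolves (F : graded_free_system) (I : A -> Prop) : Prop :=
  [/\ forall p, I p <-> exists v : 'rV[A]_(rk F 0), (v *m aug F) 0 0 = p,
      forall v : 'rV[A]_(rk F 0),
        v *m aug F = 0 <-> exists w : 'rV[A]_(rk F 1), w *m dif F 0 = v
    & forall i (v : 'rV[A]_(rk F i.+1)),
        v *m dif F i = 0 <-> exists w : 'rV[A]_(rk F i.+2), w *m dif F i.+1 = v].

(* The image of F_(i+1) is contained in (x_1, ..., x_n) F_i. *)
Definition minimal_system (F : graded_free_system) : Prop :=
  forall i k l, (dif F i k l)@_0%MM = 0.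

Definition linear_system (F : graded_free_system) (e : nat) : Prop :=
  forall i (k : 'I_(rk F i)), sh k = (e + i)%N.

(* The minimal graded free resolution is unique up to isomorphism, so that it
   is e-linear as soon as one of its copies is. *)
Definition has_linear_resolution (I : A -> Prop) : Prop :=
  exists e, generated_in_degree I e /\
    exists F, [/\ resolves F I, minimal_system F & linear_system F e].

End Resolutions.

Section Facts.

Variable K : fieldType.

Lemma ideal_of_monomials_ideal n (S : 'X_{1..n} -> Prop) :
  is_ideal (@ideal_of_monomials K n S).
Proof.
split=> [J [J0 _ _] _ //|p q hp hq J hJ hS|a p hp J hJ hS].
- by case: (hJ) => _ JD _; apply: JD; [apply: hp|apply: hq].
- by case: (hJ) => _ _ JM; apply: JM; apply: hp.
Qed.

Lemma ideal_of_monomials_gen n (S : 'X_{1..n} -> Prop) m :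
  S m -> @ideal_of_monomials K n S 'X_[m].
Proof. by move=> Sm J _; apply. Qed.

Lemma ideal_of_monomials_supp n (S : 'X_{1..n} -> Prop) p m :
  @ideal_of_monomials K n S p -> m \in msupp p ->
  exists2 u, S u & (u <= m)%MM.
Proof.
move=> hp; move: m; apply: (hp (fun p : {mpoly K[n]} =>
  forall m, m \in msupp p -> exists2 u, S u & (u <= m)%MM)).
- split=> [m|p1 q h1 h2 m /msuppD_le|a p1 h1 m /msuppM_le].
  + by rewrite msupp0.
  + by rewrite mem_cat => /orP[/h1|/h2].
  + case/allpairsP=> -[m1 m2] /= [_ /h1[u Su le_u] ->]; exists u => //.
    exact: lepm_trans le_u (lem_addl _ _).
- by move=> u Su m; rewrite msuppX inE => /eqP->; exists u => //; apply: lepm_refl.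
Qed.

Lemma monomially_generates_gen n S (I : {mpoly K[n]} -> Prop) m :
  monomially_generates S I -> S m -> I 'X_[m].
Proof. by move=> gS Sm; apply: (gS _).2; apply: ideal_of_monomials_gen. Qed.

Lemma mingens_least n (I : {mpoly K[n]} -> Prop) S u :
  monomially_generates S I -> mingens I u -> S u.
Proof.
move=> gS [Iu umin].
have [|v Sv le_vu] := ideal_of_monomials_supp (m := u) ((gS _).1 Iu).
  by rewrite msuppX inE.
by rewrite -(umin v) //; apply: monomially_generates_gen gS Sv.
Qed.

Lemma mingens_generates n (I : {mpoly K[n]} -> Prop) :
  monomial_ideal I -> monomially_generates (mingens I) I.
Proof.
case=> S gS p; split; last first.
  move=> hp; apply: (gS p).2; apply: (hp (ideal_of_monomials S)).
    exact: ideal_of_monomials_ideal.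
  by move=> m [/(gS _).1].
have [_ _ GM] := @ideal_of_monomials_ideal _ (mingens I).
move=> Ip; apply: ((gS p).1 Ip (ideal_of_monomials (mingens I))).
  exact: ideal_of_monomials_ideal.
move=> m Sm.
have := monomially_generates_gen gS Sm.
move: {2}(mdeg m).+1 (ltnSn (mdeg m)) => k; elim: k m {Sm} =>
  // k IHk m lt_mk Im.
case: (Classical_Prop.classic (mingens I m)) => [|nGm].
  exact: ideal_of_monomials_gen.
case: (Classical_Prop.classic
        (exists v, [/\ I 'X_[v], (v <= m)%MM & v <> m])); last first.
  move=> nex; case: nGm; split=> // v Iv le_vm.
  by apply: Classical_Prop.NNPP => ne_vm; apply: nex; exists v.
case=> v [Iv le_vm ne_vm]; rewrite -(submK le_vm) mpolyXD; apply: GM.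
apply: IHk => //; rewrite ltnS in lt_mk; apply: leq_trans lt_mk.
have dE := mdegD (m - v)%MM v; rewrite submK // in dE.
rewrite dE -[X in (X < _)%N]add0n ltn_add2r lt0n mdeg_eq0.
by apply/eqP=> z; apply: ne_vm; rewrite -[RHS](submK le_vm) z add0m.
Qed.

Lemma localize_substX n (P : {set 'I_n}) (m : 'X_{1..n}) :
  localize_subst P ('X_[m] : {mpoly K[n]}) =
  'X_[[multinom m (enum_val k) | k < #|P|]].
Proof.
rewrite /localize_subst comp_mpolyX [RHS]mpolyXE_id /=.
rewrite (bigID (mem P)) /= [X in _ * X]big1 ?mulr1; last first.
  move=> i nPi; rewrite tnth_mktuple /localize_var.
  case: pickP => [k /eqP ki|]; last by rewrite expr1n.
  by rewrite -ki enum_valP in nPi.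
rewrite big_enum_val /=; apply: eq_bigr => k _.
rewrite tnth_mktuple mnmE /localize_var.
by case: pickP => [l /eqP/enum_val_inj->|/(_ k)] //; rewrite eqxx.
Qed.

Lemma localize_subst_surj n (P : {set 'I_n}) (q : {mpoly K[#|P|]}) :
  exists p : {mpoly K[n]}, localize_subst P p = q.
Proof.
elim/mpolyind: q => [|c m q _ _ [p <-]].
  by exists 0; rewrite /localize_subst comp_mpoly0.
pose m' := [multinom \sum_(k < #|P| | enum_val k == i) m k | i < n].
exists (c *: 'X_[m'] + p); rewrite /localize_subst comp_mpolyD comp_mpolyZ.
rewrite -!/(localize_subst _ _) localize_substX; congr (_ *: 'X_[_] + _).
apply/mnmP=> k; rewrite !mnmE (big_pred1 k) // => l /=.
by rewrite (inj_eq enum_val_inj).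
Qed.

Lemma localize_monomial n (P : {set 'I_n}) (I : {mpoly K[n]} -> Prop) :
  monomial_ideal I -> monomial_ideal (localize P I).
Proof.
case=> S gS.
have [I0 ID IM] : is_ideal I.
  have [S0 SD SM] := @ideal_of_monomials_ideal n S; split; first exact: (gS _).2.
  - by move=> p q /(gS _).1 hp /(gS _).1 hq; apply: (gS _).2; apply: SD.
  - by move=> a p /(gS _).1 hp; apply: (gS _).2; apply: SM.
pose T (u : 'X_{1..#|P|}) :=
  exists2 m, S m & u = [multinom m (enum_val k) | k < #|P|].
have [T0 TD TM] := @ideal_of_monomials_ideal _ T.
exists T => q; split.
- case=> p /(gS _).1 hp ->.
  apply: (hp (fun p => ideal_of_monomials T (localize_subst P p))) => [|m Sm].
    split=> [|p1 p2|a p1]; rewrite /localize_subst.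
    + by rewrite comp_mpoly0.
    + by rewrite comp_mpolyD; apply: TD.
    + by rewrite rmorphM; apply: TM.
  by rewrite localize_substX; apply: ideal_of_monomials_gen; exists m.
- apply=> [|u [m Sm ->]]; last first.
    by exists 'X_[m]; [exact: monomially_generates_gen gS Sm|rewrite localize_substX].
  split=> [|_ _ [p1 h1 ->] [p2 h2 ->]|a _ [p1 h1 ->]].
  + by exists 0 => //; rewrite /localize_subst comp_mpoly0.
  + by exists (p1 + p2); [exact: ID|rewrite /localize_subst comp_mpolyD].
  + have [b <-] := localize_subst_surj a.
    by exists (b * p1); [exact: IM|rewrite /localize_subst rmorphM].
Qed.

End Facts.

(* Main.v *)
(* For a set P of variables let f(P) be the degree in which the localization I(P)
   is generated. That I(P) is generated in a single degree for all P makes f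
   supermodular: below a monomial of least degree on A :&: B there is one that also
   has least degree on A :|: B. That I(P) has a
   linear resolution gives, as H^0_m(R/I) vanishes in degrees >= reg I, that I(P)
   is the part of degree >= f(P) of its saturation, i.e. of the intersection of
   the I(P \ x); by induction on P, v is in I(P) iff the degree of v on A is at
   least f(A) for all subsets A of P. So the generators of I are the integer
   points of a base polytope, and I is polymatroidal. Conversely the
   localizations of a polymatroidal ideal are polymatroidal, and such ideals
   have linear quotients. *)
Require Import Defs.
From Stdlib Require Import Classical_Prop ClassicalEpsilon.
From mathcomp Require Import all_boot all_order all_algebra zify.
From mathcomp.multinomials Require Import mpoly.

Import Order.TTheory GRing.Theory.
Local Open Scope ring_scope.

(** * Matrices of polynomials with prescribed monomial supports *)

Section Supports.

Context {K : fieldType} {n : nat}.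
Local Notation A := {mpoly K[n]}.
Implicit Types (U W : 'X_{1..n} -> Prop) (u m : 'X_{1..n}).

(** One predicate serves for homogeneity, for lower bounds on the order, and for membership of all
    entries in a monomial ideal. *)
Definition supp_in U {p q} (M : 'M[A]_(p, q)) :=
  forall i j m, (M i j)@_m != 0 -> U m.

Lemma supp_in_sub {U W p q} {M : 'M[A]_(p, q)} :
  (forall m, U m -> W m) -> supp_in U M -> supp_in W M.
Proof. by move=> UW hM i j m /hM/UW. Qed.

Lemma supp_in0 U p q : supp_in U (0 : 'M[A]_(p, q)).
Proof. by move=> i j m; rewrite mxE mcoeff0 eqxx. Qed.

Lemma supp_inD {U p q} {M N : 'M[A]_(p, q)} :
  supp_in U M -> supp_in U N -> supp_in U (M + N).
Proof.
move=> hM hN i j m; rewrite mxE mcoeffD => nz.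
have [z|/hM//] := eqVneq ((M i j)@_m) 0.
by apply: (hN i j); rewrite z add0r in nz.
Qed.

Lemma supp_inN {U p q} {M : 'M[A]_(p, q)} : supp_in U M -> supp_in U (- M).
Proof. by move=> hM i j m; rewrite mxE mcoeffN oppr_eq0 => /hM. Qed.

Lemma supp_inB {U p q} {M N : 'M[A]_(p, q)} :
  supp_in U M -> supp_in U N -> supp_in U (M - N).
Proof. by move=> hM hN; exact: supp_inD hM (supp_inN hN). Qed.

Lemma mcoeffM_neq0 (p q : A) m : (p * q)@_m != 0 ->
  exists m1 m2, [/\ p@_m1 != 0, q@_m2 != 0 & m = (m1 + m2)%MM].
Proof.
rewrite -mcoeff_msupp => /msuppM_le /allpairsP[[m1 m2] /= [h1 h2 ->]].
by exists m1, m2; rewrite -!mcoeff_msupp.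
Qed.

Lemma mcoeff_sum_neq0 (J : finType) (F : J -> A) m :
  (\sum_j F j)@_m != 0 -> exists j, (F j)@_m != 0.
Proof.
move=> nz; apply/existsP; apply: contraNT nz => /existsPn h.
rewrite raddf_sum big1 //= => j _; apply/eqP; have := h j.
by rewrite negbK.
Qed.

Lemma supp_in_mulmx {U W V p q s} {M : 'M[A]_(p, q)} {N : 'M[A]_(q, s)} :
  (forall m1 m2, U m1 -> W m2 -> V (m1 + m2)%MM) ->
  supp_in U M -> supp_in W N -> supp_in V (M *m N).
Proof.
move=> UWV hM hN i j m; rewrite mxE => /mcoeff_sum_neq0[k].
by case/mcoeffM_neq0=> m1 [m2 [/hM h1 /hN h2 ->]]; apply: UWV.
Qed.

Lemma supp_inX {U W p q} i {M : 'M[A]_(p, q)} :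
  (forall m, U m -> W (U_(i) + m)%MM) -> supp_in U M -> supp_in W ('X_i *: M).
Proof.
move=> UW hM j k m; rewrite mxE => /mcoeffM_neq0[m1 [m2 [+ /hM h ->]]].
rewrite mcoeffX; case: (U_(i)%MM =P m1) => [<- _|]; first exact: UW.
by rewrite mulr0n eqxx.
Qed.

Lemma mcoeffXM (p : A) u m : ('X_[u] * p)@_(u + m) = p@_m.
Proof. by rewrite mulrC mcoeffMX. Qed.

Definition mproj (b : pred 'X_{1..n}) (p : A) : A :=
  \sum_(m <- msupp p | b m) p@_m *: 'X_[m].

Lemma mcoeff_mproj b p m : (mproj b p)@_m = if b m then p@_m else 0.
Proof.
rewrite /mproj raddf_sum /=.
under eq_bigr do rewrite mcoeffZ mcoeffX.
have [hm|hm] := boolP (m \in msupp p); last first.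
  rewrite (memN_msupp_eq0 hm) if_same big_seq_cond big1 // => k /andP[hk _].
  case: eqP => [km|_]; last by rewrite mulr0.
  by rewrite km (negbTE hm) in hk.
rewrite big_mkcond (bigD1_seq m) ?msupp_uniq //= eqxx mulr1.
rewrite big1 ?addr0 // => k /negbTE ->.
by rewrite mulr0 if_same.
Qed.

Definition mxproj b {p q} (M : 'M[A]_(p, q)) := map_mx (mproj b) M.

Lemma supp_in_mxprojE (b : pred 'X_{1..n}) {p q} (M : 'M[A]_(p, q)) :
  supp_in b (mxproj b M).
Proof. by move=> i j m; rewrite mxE mcoeff_mproj; case: ifP; rewrite ?eqxx. Qed.

Lemma supp_in_mxprojC (b : pred 'X_{1..n}) {p q} (M : 'M[A]_(p, q)) :
  supp_in (fun m => ~~ b m) (M - mxproj b M).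
Proof.
move=> i j m; rewrite !mxE mcoeffB mcoeff_mproj.
by case: ifP; rewrite ?subrr ?eqxx.
Qed.

Lemma mxproj_id {b : pred 'X_{1..n}} {p q} {M : 'M[A]_(p, q)} :
  supp_in b M -> mxproj b M = M.
Proof.
move=> hM; apply/matrixP => i j; apply/mpolyP => m; rewrite mxE mcoeff_mproj.
by case: ifPn => // nb; apply/esym/eqP; apply: contraNT nb => /hM.
Qed.

(** Multiplication by [N] raises every degree by exactly [c], so the part of [M] outside degree [t]
    contributes nothing in degree [t + c]. *)
Lemma mxproj_mulmx_homog c t {p q s} (M : 'M[A]_(p, q)) (N : 'M[A]_(q, s)) :
  supp_in (fun m => mdeg m = c) N ->
  mxproj (fun m => mdeg m == t + c)%N (M *m N) =
  mxproj (fun m => mdeg m == t) M *m N.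
Proof.
move=> hN; set M1 := mxproj _ M.
have h1 : supp_in (fun m => mdeg m = t + c)%N (M1 *m N).
  apply: supp_in_mulmx _ (supp_in_mxprojE _ _) hN => m1 m2 /eqP e1 e2.
  by rewrite mdegD e1 e2.
have h2 : supp_in (fun m => mdeg m != t + c)%N ((M - M1) *m N).
  apply: supp_in_mulmx _ (supp_in_mxprojC _ _) hN => m1 m2 e1 e2.
  by rewrite mdegD e2 eqn_add2r.
apply/matrixP => i j; apply/mpolyP => m; rewrite mxE mcoeff_mproj.
have -> : M *m N = M1 *m N + (M - M1) *m N by rewrite -mulmxDl addrC subrK.
rewrite [in LHS]mxE mcoeffD; case: eqP => e.
  have [->|/h2] := eqVneq ((((M - M1) *m N) i j)@_m) 0; first by rewrite addr0.
  by rewrite e eqxx.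
by apply/esym/eqP; apply: contra_notT e => /h1.
Qed.

Lemma supp_in_False {p q} {M : 'M[A]_(p, q)} {U} :
  (forall m, ~ U m) -> supp_in U M -> M = 0.
Proof.
move=> nU hM; apply/matrixP => i j; apply/mpolyP => m; rewrite mxE mcoeff0.
by apply/eqP; apply/negPn/negP => /hM/nU.
Qed.

Definition divX (i : 'I_n) (p : A) : A :=
  \sum_(m <- msupp p | m i != 0%N) p@_m *: 'X_[m - U_(i)].

Lemma mulX_divX i p : 'X_i * divX i p = mproj (fun m => m i != 0%N) p.
Proof.
rewrite mulr_sumr; apply: eq_bigr => m mi.
by rewrite -scalerAr -mpolyXD addmC submK // lep1mP.
Qed.

End Supports.

(** * Socle elements and linear complexes: reduction modulo the variables one at a time *)

Section Socle.

Context {K : fieldType} {n : nat}.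
Local Notation A := {mpoly K[n]}.

(* Membership in the ideal (x_0, ..., x_{j-1}). *)
Definition meets_first j : pred 'X_{1..n} :=
  fun m => [exists l : 'I_n, (l < j)%N && (m l != 0%N)].
Local Notation inM j := (supp_in (meets_first j)).

Lemma meets_firstD j m1 m2 :
  meets_first j m1 -> meets_first j (m1 + m2)%MM.
Proof.
case/existsP=> l /andP[lj nz]; apply/existsP; exists l.
by rewrite lj mnmDE addn_eq0 negb_and nz.
Qed.

Lemma meets_firstS j m : meets_first j m -> meets_first j.+1 m.
Proof.
by case/existsP=> l /andP[lj nz]; apply/existsP; exists l; rewrite ltnS ltnW.
Qed.

Lemma inMX {j} i {p q} {M : 'M[A]_(p, q)} : inM j M -> inM j ('X_i *: M).
Proof. by apply: supp_inX => m /meets_firstD; rewrite addmC; apply. Qed.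

Lemma inM_mul {j p q s} {M : 'M[A]_(p, q)} (N : 'M[A]_(q, s)) :
  inM j M -> inM j (M *m N).
Proof.
move=> hM; apply: (supp_in_mulmx (W := fun _ => True) _ hM) => // m1 m2 h _.
exact: meets_firstD.
Qed.

Lemma inM0P {p q} {M : 'M[A]_(p, q)} : inM 0 M -> M = 0.
Proof. by apply: supp_in_False => m /existsP[l]; rewrite ltn0. Qed.

(** The ideal is monomial and [x_i] is not among its variables, so [x_i] is a nonzerodivisor modulo
    it. *)
Lemma inM_regular {j} (i : 'I_n) {p q} {M : 'M[A]_(p, q)} :
  (j <= i)%N -> inM j ('X_i *: M) -> inM j M.
Proof.
move=> ji hM k l m nz.
have : meets_first j (U_(i) + m)%MM.
  by apply: (hM k l); rewrite mxE mcoeffXM.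
case/existsP=> a /andP[aj]; rewrite mnmDE mnm1E => h.
apply/existsP; exists a; rewrite aj /=; apply: contra h => /eqP ->.
by rewrite addn0 eqb0; apply: contraTneq aj => <-; rewrite -leqNgt.
Qed.

(** The terms divisible by [x_j] are divided by it to give [N]; every other term must involve an
    earlier variable. *)
Lemma inM_split (j : 'I_n) {p q} {M : 'M[A]_(p, q)} :
  inM j.+1 M -> exists N, inM j (M - 'X_j *: N).
Proof.
move=> hM; exists (map_mx (divX j) M).
have -> : 'X_j *: map_mx (divX j) M = mxproj (fun m => m j != 0%N) M.
  by apply/matrixP => k l; rewrite !mxE mulX_divX.
move=> k l m; rewrite !mxE mcoeffB mcoeff_mproj.
case: ifPn => [|/negPn mj]; first by rewrite subrr eqxx.
rewrite subr0 => /hM /existsP[a /andP[aj nz]]; apply/existsP; exists a.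
rewrite nz andbT ltn_neqAle -ltnS aj andbT.
by apply: contraNneq nz => /val_inj ->.
Qed.

Variables (r : nat -> nat) (D : forall i, 'M[A]_(r i.+1, r i)) (c : nat -> nat).
Hypothesis cS : forall i, c i.+1 = 1%N.
Hypothesis D_homog : forall i, supp_in (fun m => mdeg m = c i) (D i).
Hypothesis D_complex : forall i, D i.+1 *m D i = 0.
Hypothesis D_exact : forall i (v : 'rV_(r i.+1)),
  v *m D i = 0 -> exists w, w *m D i.+1 = v.

(* As x_0, ..., x_{j-1} are regular on free modules, reducing the complex modulo
   each of them loses exactness at one more position only. *)
Lemma exact_mod {j i} (v : 'rV_(r i.+1)) : (j <= i)%N -> (j <= n)%N ->
  inM j (v *m D i) -> exists w, inM j (v - w *m D i.+1).
Proof.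
elim: j i v => [|j IH] i v ji jn hv.
  have [w <-] := D_exact _ _ (inM0P hv); exists w; rewrite subrr; exact: supp_in0.
case: i v ji hv => [//|i] v ji hv.
(* Modulo the first [j] variables [v D = x_j y]. Since [x_j] is regular, [y] is a cycle, hence a
   boundary [w D], and [v - x_j w] is a cycle to which induction applies. *)
have [y hy] := inM_split (Ordinal jn) hv.
set x := 'X_(Ordinal jn) in hy *.
have [w hw] : exists w, inM j (y - w *m D i.+1).
  apply: IH => //; first exact: ltnW.
  apply: (inM_regular (Ordinal jn)) => //.
  have := supp_inN (inM_mul (D i) hy).
  by rewrite mulmxBl -mulmxA D_complex mulmx0 sub0r opprK -scalemxAl.
have [w' hw'] : exists w', inM j (v - x *: w - w' *m D i.+2).
  apply: IH; [exact: ltnW | exact: ltnW |].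
  have := supp_inD hy (inMX (Ordinal jn) hw); rewrite -/x.
  by rewrite scalerBr addrA subrK mulmxBl scalemxAl.
exists w'; have -> : v - w' *m D i.+2 = v - x *: w - w' *m D i.+2 + x *: w.
  by rewrite addrAC subrK.
apply: supp_inD; first by apply: supp_in_sub _ hw' => m; apply: meets_firstS.
apply: (supp_inX (U := fun _ => True)) => // m _; apply/existsP.
by exists (Ordinal jn); rewrite /= ltnS leqnn mnmDE mnm1E eqxx.
Qed.

Lemma lift_order {j i} {z : 'rV_(r i)} {y : 'rV_(r i.+1)} :
  supp_in (fun m => c i < mdeg m)%N z -> inM j (z - y *m D i) ->
  exists2 y', supp_in (fun m => 0 < mdeg m)%N y' & inM j (z - y' *m D i).
Proof.
move=> hz hy; set y0 := mxproj (fun m => mdeg m == 0)%N y.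
have hy' : supp_in (fun m => 0 < mdeg m)%N (y - y0).
  by apply: supp_in_sub _ (supp_in_mxprojC _ _) => m; rewrite lt0n.
exists (y - y0) => //; rewrite mulmxBl opprB addrCA addrC.
apply: supp_inD => //= a b m nz.
have dm : mdeg m = c i.
  move: a b m nz; apply: supp_in_mulmx _ (supp_in_mxprojE _ _) (D_homog i).
  by move=> m1 m2 /eqP e1 e2; rewrite mdegD e1 e2.
apply: (hy a b); have -> : z - y *m D i = z - (y - y0) *m D i - y0 *m D i.
  by rewrite mulmxBl opprB addrA addrAC -!addrA subrr addr0.
rewrite mxE mcoeffD mxE mcoeffD.
have -> : (z a b)@_m = 0.
  by apply/eqP; apply: contraT => /hz; rewrite dm ltnn.
have -> : ((- ((y - y0) *m D i)) a b)@_m = 0.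
  apply/eqP; apply: contraT.
  have h : supp_in (fun m => c i < mdeg m)%N (- ((y - y0) *m D i)).
    apply/supp_inN/(supp_in_mulmx _ hy' (D_homog i)).
    by move=> m1 m2 h1 h2; rewrite mdegD h2 -[X in (X < _)%N]add0n ltn_add2r.
  by move/h; rewrite dm ltnn.
by rewrite add0r add0r mxE mcoeffN oppr_eq0.
Qed.

(* x_j z lifts to some y one step up the complex, and y satisfies the same
   hypotheses modulo x_j as well; once all variables are used up, the claim is
   that y has positive order. *)
Lemma socle_mod k {j} (z : 'rV_(r j)) : (0 < c n)%N -> (j + k)%N = n ->
  supp_in (fun m => c j <= mdeg m)%N z ->
  (forall l : 'I_n, (j <= l)%N -> exists w, inM j ('X_l *: z - w *m D j)) ->
  exists w, inM j (z - w *m D j).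
Proof.
move=> cn; elim: k j z => [|k IH] j z jk hz hx.
  exists 0; rewrite mul0mx subr0; rewrite addn0 in jk; subst j.
  apply: supp_in_sub _ hz => m /(leq_trans cn).
  rewrite lt0n mdeg_eq0 => m0; apply: contraNT m0 => /existsPn h.
  apply/eqP/mnmP => l; rewrite mnm0E; have := h l.
  by rewrite ltn_ord negbK => /eqP.
have jn : (j < n)%N by rewrite -jk addnS ltnS leq_addr.
pose x : A := 'X_(Ordinal jn).
have hxm p q (M : 'M[A]_(p, q)) : inM j.+1 (x *: M).
  apply: (supp_inX (U := fun _ => True)) => // m _; apply/existsP.
  by exists (Ordinal jn); rewrite /= ltnS leqnn mnmDE mnm1E eqxx.
have [y1 hy1] := hx (Ordinal jn) (leqnn j).
have [|y yp hy] := lift_order _ hy1.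
  by apply: supp_inX _ _ hz => m; rewrite mdegD mdeg1 add1n ltnS.
have [|||w hw] := IH j.+1 y.
- by rewrite -jk addnS.
- by rewrite cS.
- move=> l jl; have [w1 hw1] := hx l (ltnW jl).
  (* Modulo the first [j] variables, [x_l z = w1 D] and [x z = y D], so that [x_l y - x w1] is a
     cycle. *)
  have [|||w hw] := exact_mod (j := j) ('X_l *: y - x *: w1).
  + exact: leqnn.
  + exact: ltnW.
  + have := supp_inB (inMX (Ordinal jn) hw1) (inMX l hy); rewrite -/x !scalerBr.
    rewrite !scalerA (mulrC x) mulmxBl -!scalemxAl opprB addrC addrA.
    by rewrite scalemxAl subrK.
  exists w; have -> : 'X_l *: y - w *m D j.+1 =
      'X_l *: y - x *: w1 - w *m D j.+1 + x *: w1 by rewrite addrAC subrK.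
  apply: supp_inD => //; apply: supp_in_sub _ hw => m; exact: meets_firstS.
(* Now [y = w D + x b], whence [x z = y D = x b D], and [x] can be cancelled. *)
have [b hb] := inM_split (Ordinal jn) hw; rewrite -/x in hb.
exists b; apply: (inM_regular (Ordinal jn)) => //; rewrite -/x.
have := supp_inD hy (inM_mul (D j) hb).
rewrite !mulmxBl -mulmxA D_complex mulmx0 subr0 addrA subrK scalerBr.
by rewrite scalemxAl.
Qed.

End Socle.

(** * Supermodular rank functions, tight sets and the exchange property *)

Section Exchange.

Context {n : nat}.
Implicit Types (u v w m : 'X_{1..n}) (A B P T : {set 'I_n}).

Definition degon A m : nat := (\sum_(i in A) m i)%N.

Lemma degonT m : degon [set: 'I_n] m = mdeg m.
Proof. by rewrite mdegE; apply: eq_bigl => i; rewrite inE. Qed.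

Lemma degonD A u v : degon A (u + v)%MM = (degon A u + degon A v)%N.
Proof. by rewrite -big_split; apply: eq_bigr => i _; rewrite mnmDE. Qed.

Lemma degonU A (i : 'I_n) : degon A U_(i)%MM = (i \in A).
Proof.
rewrite /degon (eq_bigr (fun j => (i == j) : nat)) => [|j _]; last exact: mnm1E.
have [iA|iA] := boolP (i \in A).
  by rewrite (bigD1 i) //= eqxx big1 // => j /andP[_]; rewrite eq_sym => /negbTE->.
by rewrite big1 // => j jA; case: eqP iA => // ->; rewrite jA.
Qed.

Lemma degon_modular A B m :
  (degon (A :|: B) m + degon (A :&: B) m = degon A m + degon B m)%N.
Proof.
rewrite /degon 4!(big_mkcond (fun i => i \in _)) /=.
rewrite -!big_split /=; apply: eq_bigr => i _; rewrite !inE.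
by case: (i \in A); case: (i \in B); rewrite /= ?addn0.
Qed.

Lemma leq_degon A u v :
  (forall i, i \in A -> u i <= v i)%N -> (degon A u <= degon A v)%N.
Proof. exact: leq_sum. Qed.

(* [M] is the set of monomials of an ideal, and [inloc P] is membership in its
   localization at the prime generated by the variables in [P]. *)
Variables (M : 'X_{1..n} -> Prop) (f : {set 'I_n} -> nat).
Hypothesis M_up : forall u v, M u -> (u <= v)%MM -> M v.

Definition inloc P v := exists2 w, M w & forall i, i \in P -> (w i <= v i)%N.

Hypothesis M_ex : exists u, M u.
Hypothesis f_min : forall P w, M w -> (f P <= degon P w)%N.
Hypothesis f_attained : forall P u, M u ->
  exists w, [/\ M w, forall i, i \in P -> (w i <= u i)%N & degon P w = f P].
Hypothesis loc_saturated : forall P v, P != set0 -> (f P <= degon P v)%N ->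
  (forall j, j \in P -> inloc (P :\ j) v) -> inloc P v.

Lemma f_supermodular A B : (f A + f B <= f (A :|: B) + f (A :&: B))%N.
Proof.
have [u Mu] := M_ex; have [w [Mw _ wI]] := f_attained (A :&: B) u Mu.
have [w' [Mw' w'w w'U]] := f_attained (A :|: B) w Mw.
apply: leq_trans (leq_add (f_min A w' Mw') (f_min B w' Mw')) _.
rewrite -degon_modular w'U leq_add2l -wI; apply: leq_degon => i.
by rewrite inE => /andP[iA _]; apply: w'w; rewrite inE iA.
Qed.

Lemma inloc_degon P v :
  (forall A, A \subset P -> f A <= degon A v)%N -> inloc P v.
Proof.
have [k] := ubnP #|P|; elim: k P => // k IH P; rewrite ltnS => Pk h.
have [->|P0] := eqVneq P set0.
  by have [u Mu] := M_ex; exists u => // i; rewrite inE.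
apply: loc_saturated => // [|j jP]; first exact: h.
apply: IH => [|A AP]; last by apply: h; apply: subset_trans AP (subsetDl _ _).
by apply: leq_trans Pk; rewrite [in X in (_ < X)%N](cardsD1 j P) jP.
Qed.

(** The degree of [u] is modular in the set and bounds the supermodular [f] from above, so equality
    at [A] and [B] forces equality at their union and intersection. *)
Lemma tightI u A B : M u -> degon A u = f A -> degon B u = f B ->
  degon (A :&: B) u = f (A :&: B).
Proof.
move=> Mu tA tB; have := f_supermodular A B; have := degon_modular A B u.
have := f_min (A :&: B) u Mu; have := f_min (A :|: B) u Mu.
by rewrite tA tB; lia.
Qed.

(* x_i can be exchanged for any x_j with j in the smallest tight set T around i,
   as all tight sets around i contain T; and v cannot be below u on T. *)
Lemma exchange u v (i : 'I_n) : M u -> M v -> mdeg u = f [set: 'I_n] ->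
  (v i < u i)%N -> exists j : 'I_n, (u j < v j)%N /\ M (u - U_(i) + U_(j))%MM.
Proof.
move=> Mu Mv du ltvu.
pose tight A := (i \in A) && (degon A u == f A).
have tT : tight [set: 'I_n] by rewrite /tight inE degonT du eqxx.
have [T /andP[iT /eqP tightT] Tmin] := arg_minnP (fun A => #|A|) tT.
(* Otherwise [v] is at most [u] on [T] and strictly smaller at [i], so its degree on [T] falls below
   [f T]. *)
have [j jT ltuv] : exists2 j, j \in T & (u j < v j)%N.
  apply/exists_inP; apply: contraT => /exists_inPn h.
  have := f_min T v Mv; rewrite -tightT leqNgt /degon.
  rewrite (bigD1 i) //= [X in (_ < X)%N](bigD1 i) //=.
  rewrite -addSn leq_add // leq_sum // => k /andP[kT _].
  by rewrite leqNgt h.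
exists j; split=> //.
have le1u : (U_(i) <= u)%MM by rewrite lep1mP -lt0n (leq_ltn_trans _ ltvu).
have [w Mw wu] : inloc [set: 'I_n] (u - U_(i) + U_(j))%MM.
  apply: inloc_degon => A _; rewrite degonD degonU.
  have := degonD A (u - U_(i))%MM U_(i)%MM; rewrite submK // degonU.
  have := f_min A u Mu.
  case: (boolP (j \in A)) => [_|jA]; case: (boolP (i \in A)) => [iA|_]; try lia.
  rewrite leq_eqVlt => /orP[/eqP tA|]; last lia.
  (* Only a tight [A] containing [i] but not [j] could violate the bound; then [T :&: A] would be a
     smaller tight set around [i]. *)
  have /Tmin : tight (T :&: A).
    by rewrite /tight inE iT iA /= tightI ?eqxx.
  have : T :&: A \proper T.
    rewrite properEneq subsetIl andbT.
    by apply: contraNneq jA => /setIidPl/subsetP->.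
  by move/proper_card; rewrite ltnNge => /negP.
by apply: M_up Mw _; apply/mnm_lepP => k; apply: wu; rewrite inE.
Qed.

End Exchange.

(** * Monomials of a monomial ideal and of its localizations *)

Section MonomialMembership.

Context {K : fieldType} {n : nat} {I : {mpoly K[n]} -> Prop}.
Hypothesis I_mon : monomial_ideal I.

Lemma monomial_is_ideal : is_ideal I.
Proof.
have [S gS] := I_mon; have [S0 SD SM] := @ideal_of_monomials_ideal K n S.
split; first exact: (gS _).2.
- by move=> p q /(gS _).1 hp /(gS _).1 hq; apply: (gS _).2; apply: SD.
- by move=> a p /(gS _).1 hp; apply: (gS _).2; apply: SM.
Qed.

Lemma monomial_up {u v} : I 'X_[u] -> (u <= v)%MM -> I 'X_[v].
Proof.
have [_ _ IM] := monomial_is_ideal.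
by move=> Iu uv; rewrite -(submK uv) mpolyXD; apply: IM.
Qed.

Lemma mem_mingens_le {m} : I 'X_[m] -> exists2 u, mingens I u & (u <= m)%MM.
Proof.
move=> /(mingens_generates I_mon) h; apply: (ideal_of_monomials_supp h).
by rewrite msuppX inE.
Qed.

Lemma mingens_of_mdeg d u : generated_in_degree I d -> I 'X_[u] ->
  mdeg u = d -> mingens I u.
Proof.
move=> [_ Gd] Iu du; have [g Gg gu] := mem_mingens_le Iu.
suff -> : u = g by [].
have := mdegD (u - g)%MM g; rewrite submK // du (Gd g Gg) -[X in X = _]add0n.
move=> /addIn/esym/eqP; rewrite mdeg_eq0 => /eqP ug.
by rewrite -[u](submK gu) ug add0m.
Qed.

Lemma mem_monomialP p : I p <-> forall m, p@_m != 0 -> I 'X_[m].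
Proof.
have [I0 ID IM] := monomial_is_ideal; split=> [Ip m|h].
  rewrite -mcoeff_msupp.
  case/(ideal_of_monomials_supp ((mingens_generates I_mon _).1 Ip)) => u [Iu _].
  exact: monomial_up.
rewrite [p]mpolyE big_seq; elim/big_ind: _ => // m.
by rewrite mcoeff_msupp -mul_mpolyC => /h; apply: IM.
Qed.

Definition restr (P : {set 'I_n}) (m : 'X_{1..n}) : 'X_{1..#|P|} :=
  [multinom m (enum_val k) | k < #|P|].

Lemma mdeg_restr P m : mdeg (restr P m) = degon P m.
Proof.
by rewrite mdegE [RHS]big_enum_val; apply: eq_bigr => k _; rewrite mnmE.
Qed.

Lemma le_restrP {P : {set 'I_n}} {u v : 'X_{1..n}} :
  reflect (forall i, i \in P -> (u i <= v i)%N) (restr P u <= restr P v)%MM.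
Proof.
apply: (iffP mnm_lepP) => h i => [iP|]; last by rewrite !mnmE h ?enum_valP.
by have := h (enum_rank_in iP i); rewrite !mnmE enum_rankK_in.
Qed.

(** The substitution can merge monomials of [p], so the coefficient of [q] in the image is a sum
    over all monomials restricting to [q]. As it equals 1, at least one such monomial occurs in
    [p]. *)
Lemma localizeXP {P q} :
  localize P I 'X_[q] <-> exists2 w, I 'X_[w] & q = restr P w.
Proof.
split=> [[p Ip]|[w Iw ->]]; last first.
  by exists 'X_[w]; rewrite ?localize_substX.
rewrite [p in localize_subst _ p]mpolyE /localize_subst raddf_sum /=.
move/(congr1 (mcoeff q)); rewrite mcoeffX eqxx raddf_sum /= => h.
have : \sum_(m <- msupp p | restr P m == q) p@_m != 0.
  rewrite (_ : \sum_(_ <- _ | _) _ = 1) ?oner_eq0 // big_mkcond /=.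
  apply: etrans (esym h); apply: eq_bigr => m _.
  rewrite comp_mpolyZ -/(localize_subst P _).
  rewrite localize_substX mcoeffZ mcoeffX -/(restr P m).
  by case: eqP; rewrite ?mulr1 ?mulr0.
have [/hasP[m mp /eqP mq] _|/hasPn h'] :=
  boolP (has (fun m => restr P m == q) (msupp p)).
  by exists m => //; apply: (mem_monomialP p).1; rewrite -?mcoeff_msupp.
by rewrite big_seq_cond big1 ?eqxx // => m /andP[/h'/negP].
Qed.

Lemma localize_restrP {P v} :
  localize P I 'X_[restr P v] <-> inloc (fun m => I 'X_[m]) P v.
Proof.
rewrite localizeXP; split=> [[w Iw e]|[w Iw wv]].
  by exists w => //; apply/le_restrP; rewrite e lepm_refl.
(* Raising [w] to [v] on [P] and keeping it elsewhere gives a multiple of [w] whose restriction is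
   exactly that of [v]. *)
pose w' := [multinom if i \in P then v i else w i | i < n].
exists w'; last by apply/mnmP => k; rewrite !mnmE enum_valP.
apply: monomial_up Iw _; apply/mnm_lepP => i; rewrite mnmE.
by case: ifP => // /wv.
Qed.

End MonomialMembership.

(** * An ideal with an [e]-linear resolution agrees with its saturation in degrees at least [e] *)

Section Saturation.

Context {K : fieldType} {n : nat}.
Context {I : {mpoly K[n]} -> Prop} {e : nat} {F : graded_free_system K n}.
Hypothesis I_mon : monomial_ideal I.
Hypothesis F_res : resolves F I.
Hypothesis F_lin : linear_system F e.
Hypothesis n_gt0 : (0 < n)%N.

(** This is [socle_mod] at position 0 of the augmented resolution, applied to the monomial [q]. *)
Lemma linear_socle q : (e <= mdeg q)%N ->
  (forall l : 'I_n, I 'X_[U_(l) + q]) -> I 'X_[q].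
Proof.
have [Iaug aug_ex dif_ex] := F_res => eq Iq.
(* The ring is put at position 0 and the resolution shifted by one, so that the augmentation has
   degree [e] and all other maps have degree 1. *)
pose r i := if i is i'.+1 then rk F i' else 1%N.
pose D i : 'M[{mpoly K[n]}]_(r i.+1, r i) :=
  if i is i'.+1 then dif F i' else aug F.
pose c i := if i is _.+1 then 1%N else e.
pose z : 'rV[{mpoly K[n]}]_(r 0%N) := ('X_[q])%:M.
have [||||||||w] := socle_mod r D c _ _ _ _ n (j := 0) z.
- by [].
- case=> [|i] k l m; rewrite -mcoeff_msupp /=.
    by rewrite [l]ord1 => /aug_homog ->; rewrite F_lin addn0.
  by move=> /dif_homog; rewrite !F_lin; lia.
- by case=> [|i]; apply/row_matrixP => k; rewrite row_mul row0;
    [apply/aug_ex | apply/dif_ex]; exists (delta_mx 0 k); rewrite rowE.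
- by case=> [|i] v /=; [case/aug_ex | case/dif_ex] => w hw; exists w.
- by rewrite /c; case: (n) n_gt0.
- by [].
- move=> i j m; rewrite !ord1 mxE eqxx mcoeffX.
  by case: (q =P m) => [<-|]; rewrite ?mulr0n ?eqxx.
- move=> l _; have [v hv] := (Iaug _).1 (Iq l); exists v => /=.
  rewrite (_ : _ - _ = 0); first exact: supp_in0.
  apply/matrixP => i j; rewrite !ord1 !mxE eqxx mulr1n -mpolyXD -hv.
  by rewrite mxE subrr.
move/inM0P/subr0_eq/matrixP/(_ 0 0); rewrite mxE eqxx mulr1n => h.
by apply/Iaug; exists w.
Qed.

(** Induction on the sum of the exponents [t j]: if one vanishes, [q] is in [I] already; otherwise
    each [x_j q] satisfies the hypothesis with [t j] lowered by one, and [linear_socle] descends to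
    [q]. *)
Lemma linear_saturated q (t : 'I_n -> nat) : (e <= mdeg q)%N ->
  (forall j, I 'X_[q + U_(j) *+ t j]) -> I 'X_[q].
Proof.
have [k] := ubnP (\sum_j t j)%N; elim: k q t => // k IH q t; rewrite ltnS.
move=> tk eq It.
have [/existsP[j /eqP tj]|/existsPn tpos] := boolP [exists j, t j == 0%N].
  by have := It j; rewrite tj mulm0n addm0.
apply: linear_socle => // j; rewrite addmC.
apply: (IH _ (fun i => if i == j then (t j).-1 else t i)).
- apply: leq_trans tk; rewrite (bigD1 j) //= [X in (_ < X)%N](bigD1 j) //=.
  rewrite eqxx -addSn prednK ?lt0n ?tpos // leq_add2l leq_sum // => i.
  by move/negbTE->.
- by rewrite mdegD (leq_trans eq) ?leq_addr.
- move=> i; have [->|_] := eqVneq i j.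
    rewrite -addmA -mulmS prednK; [exact: It | by rewrite lt0n tpos].
  apply: (monomial_up I_mon (It i)).
  by apply/mnm_lepP => a; rewrite !mnmDE leq_add2r leq_addr.
Qed.

End Saturation.

(** * Linear localizations imply polymatroidality *)

Section LinearLocalizations.

Context {K : fieldType} {n : nat} {I : {mpoly K[n]} -> Prop}.
Hypothesis I_mon : monomial_ideal I.

(** The hypotheses of [exchange] are verified with [f P] the degree in which the localization at [P]
    is generated. *)
Lemma polymatroidal_of_linear d : generated_in_degree I d ->
  (forall P : {set 'I_n}, has_linear_resolution (localize P I)) ->
  polymatroidal I.
Proof.
move=> I_deg /fin_all_exists[f hf]; split=> //; first by exists d.
pose M m := I 'X_[m].
have M_up u v : M u -> (u <= v)%MM -> M v by apply: (monomial_up I_mon).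
have M_ex : exists u, M u by have [[u [Iu _]] _] := I_deg; exists u.
have f_attained (P : {set 'I_n}) u : M u ->
    exists w, [/\ M w, forall i, i \in P -> (w i <= u i)%N & degon P w = f P].
  move=> Mu; have [[_ Gf] _] := hf P.
  have : localize P I 'X_[restr P u] by apply/localizeXP => //; exists u.
  case/(mem_mingens_le (localize_monomial _ I_mon)) => q Gq qu.
  have [/(localizeXP I_mon)[w Mw e] _] := Gq; exists w; split=> //.
    by apply/le_restrP; rewrite -e.
  by rewrite -mdeg_restr -e Gf.
have f_min (P : {set 'I_n}) w : M w -> (f P <= degon P w)%N.
  case/(f_attained P w) => w' [_ w'w <-]; exact: leq_degon.
have loc_sat (P : {set 'I_n}) v : P != set0 -> (f P <= degon P v)%N ->
    (forall j, j \in P -> inloc M (P :\ j) v) -> inloc M P v.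
  move=> P0 fv hv; have [_ [F [Fres _ Flin]]] := hf P.
  (* If [w] witnesses membership in the localization at [P] without [x_j], only the exponent of
     [x_j] can be too small in [v], and adding that of [w] suffices. *)
  have step (j : 'I_#|P|) :
      exists t, localize P I 'X_[restr P v + U_(j) *+ t].
    have [w Mw wv] := hv _ (enum_valP j); exists (w (enum_val j)).
    have : localize P I 'X_[restr P w] by apply/localizeXP => //; exists w.
    move/(monomial_up (localize_monomial _ I_mon)); apply.
    apply/mnm_lepP => k; rewrite mnmDE mulmnE mnm1E !mnmE.
    have [<-|jk] := eqVneq j k; first by rewrite mul1n leq_addl.
    rewrite (leq_trans _ (leq_addr _ _)) // wv // !inE enum_valP andbT.
    by rewrite (inj_eq enum_val_inj) eq_sym.
  have [t ht] := fin_all_exists step.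
  apply/localize_restrP => //.
  apply: (linear_saturated (localize_monomial _ I_mon) Fres Flin _ _ _ _ ht).
    by rewrite card_gt0.
  by rewrite mdeg_restr.
move=> u v Gu [Mv _] i ltvu.
have [[u0 Gu0] Gd] := I_deg; have du := Gd u Gu; have [Mu _] := Gu.
have fT : f [set: 'I_n] = d.
  apply/eqP; rewrite eqn_leq -{1}du -degonT f_min //=.
  have [w [Mw _ <-]] := f_attained [set: 'I_n] u Mu; rewrite degonT.
  have [g Gg gw] := mem_mingens_le I_mon Mw; rewrite -(Gd g Gg) -!degonT.
  by apply: leq_degon => k _; apply/mnm_lepP.
have [|j [uj Mj]] :=
  exchange M f M_up M_ex f_min f_attained loc_sat u v i Mu Mv _ ltvu.
  by rewrite fT.
by exists j.
Qed.

End LinearLocalizations.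

(** * Linear resolutions as coinductive objects, and linear quotients *)

Section LinearSyzygies.

Context {K : fieldType} {n : nat}.
Local Notation A := {mpoly K[n]}.
Implicit Types (U : 'X_{1..n} -> Prop) (u m : 'X_{1..n}).

(* The submodule [Z] of a free module generated in degree 0 has a 1-linear free
   resolution. *)
CoInductive linear_syz (r : nat) (Z : 'rV[A]_r -> Prop) : Prop :=
  LinearSyz s (D : 'M[A]_(s, r)) of
    supp_in (fun m => mdeg m = 1%N) D &
    (forall v, Z v <-> exists w, w *m D = v) &
    linear_syz s (fun w => w *m D = 0).
Arguments linear_syz {r}.

(* The horseshoe construction for 0 -> ker E1 -> ker (col_mx E1 E2) -> Z2 -> 0:
   generators of the ends give generators of the middle term, whose syzygies are
   again of the form ker (col_mx E1' E2'). *)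
Lemma horseshoe (c r1 r2 t s1 s2 : nat) (E1 : 'M[A]_(r1, t))
    (E2 : 'M[A]_(r2, t)) (D1 : 'M[A]_(s1, r1)) (D2 : 'M[A]_(s2, r2)) :
  supp_in (fun m => mdeg m = c) E1 -> supp_in (fun m => mdeg m = c) E2 ->
  supp_in (fun m => mdeg m = 1%N) D1 -> supp_in (fun m => mdeg m = 1%N) D2 ->
  (forall a : 'rV_r1, a *m E1 = 0 <-> exists w, w *m D1 = a) ->
  (forall b : 'rV_r2,
    (exists a, a *m E1 + b *m E2 = 0) <-> exists w, w *m D2 = b) ->
  exists th : 'M_(s2, r1),
  [/\ supp_in (fun m => mdeg m = 1%N) (row_mx D1 (0 : 'M_(s1, r2))),
      supp_in (fun m => mdeg m = 1%N) (row_mx th D2),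
      forall v : 'rV_(r1 + r2), v *m col_mx E1 E2 = 0 <->
        exists w, w *m col_mx (row_mx D1 0) (row_mx th D2) = v,
      forall a : 'rV_s1, a *m D1 = 0 <-> a *m row_mx D1 (0 : 'M_(s1, r2)) = 0
    & forall b : 'rV_s2, b *m D2 = 0 <->
        exists a, a *m row_mx D1 0 + b *m row_mx th D2 = 0].
Proof.
move=> hE1 hE2 hD1 hD2 eD1 eD2.
have DE1 (w : 'rV_s1) : w *m D1 *m E1 = 0 by apply/eD1; exists w.
have [th hth eth] : exists2 th, supp_in (fun m => mdeg m = 1%N) th &
    th *m E1 + D2 *m E2 = 0.
  have row_th k : exists a, supp_in (fun m => mdeg m = 1%N) a /\
      a *m E1 + row k D2 *m E2 = 0.
    have [a ha] : exists a, a *m E1 + row k D2 *m E2 = 0.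
      by apply/eD2; exists (delta_mx 0 k); rewrite -rowE.
    (* The degree 1 part of a lift is again a lift, since the equation is homogeneous of degree
       [1 + c]. *)
    exists (mxproj (fun m => mdeg m == 1%N) a); split.
      by apply: supp_in_sub (supp_in_mxprojE _ _) => m /eqP.
    have {}ha : a *m E1 = - (row k D2 *m E2) by apply/eqP; rewrite -addr_eq0 ha.
    rewrite -(mxproj_mulmx_homog c) // ha mxproj_id ?addNr //.
    apply: supp_inN; apply: (supp_in_mulmx _ _ hE2 (U := fun m => mdeg m = 1%N)).
      by move=> m1 m2 e1 e2; rewrite mdegD e1 e2.
    by move=> i j m; rewrite mxE => /hD2.
  have [th hth] := fin_all_exists row_th.
  exists (\matrix_k th k).
    move=> k l m; have [h _] := hth k.
    by rewrite mxE => /h.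
  apply/row_matrixP => k; rewrite row0 linearD /= !row_mul rowK.
  by have [_] := hth k.
have hD : supp_in (fun m => mdeg m = 1%N) (row_mx D1 (0 : 'M_(s1, r2))).
  move=> k l m; rewrite mxE; case: split => ?; first exact: hD1.
  by rewrite mxE mcoeff0 eqxx.
have hD' : supp_in (fun m => mdeg m = 1%N) (row_mx th D2).
  by move=> k l m; rewrite mxE; case: split => ?; [apply: hth | apply: hD2].
exists th; split=> //.
- move=> v; rewrite -[v]hsubmxK mul_row_col; split=> [h|[w]].
    have [w2 hw2] : exists w, w *m D2 = rsubmx v.
      by apply/eD2; exists (lsubmx v).
    have [w1 hw1] : exists w, w *m D1 = lsubmx v - w2 *m th.
      apply/eD1; rewrite mulmxBl -mulmxA.
      have /eqP := eth; rewrite addr_eq0 => /eqP ->.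
      by rewrite mulmxN opprK mulmxA hw2.
    by exists (row_mx w1 w2); rewrite mul_row_block mulmx0 add0r hw1 hw2 subrK.
  rewrite -[w]hsubmxK mul_row_block mulmx0 add0r => /eq_row_mx[<- <-].
  by rewrite mulmxDl DE1 add0r -!mulmxA -mulmxDr eth mulmx0.
- move=> a; rewrite mul_mx_row mulmx0; split=> [->|/eqP].
    by rewrite row_mx0.
  by rewrite -row_mx0 => /eqP/eq_row_mx[].
- move=> b; split=> [hb|[a]].
    have [w hw] : exists w, w *m D1 = b *m th.
      apply/eD1; have /eqP := eth; rewrite addr_eq0 => /eqP h.
      by rewrite -mulmxA h mulmxN mulmxA hb mul0mx oppr0.
    exists (- w); rewrite !mul_mx_row mulmx0 add_row_mx mulNmx hw hb.
    by rewrite addNr addr0 row_mx0.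
  rewrite !mul_mx_row mulmx0 add_row_mx add0r => /eqP.
  by rewrite -row_mx0 => /eqP/eq_row_mx[].
Qed.

(** Each use of [horseshoe] reproduces the hypotheses one step up, with [c] replaced by 1. Having
    [Z1] and [Z2] fixed only up to equivalence lets the corecursive call take the tails as they
    stand, which keeps it guarded. *)
Lemma linear_syz_ker_col_mx (c r1 r2 t : nat) (E1 : 'M[A]_(r1, t))
    (E2 : 'M[A]_(r2, t)) Z1 Z2 :
  supp_in (fun m => mdeg m = c) E1 -> supp_in (fun m => mdeg m = c) E2 ->
  linear_syz Z1 -> linear_syz Z2 ->
  (forall a, Z1 a <-> a *m E1 = 0) ->
  (forall b, Z2 b <-> exists a, a *m E1 + b *m E2 = 0) ->
  linear_syz (fun v => v *m col_mx E1 E2 = 0).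
Proof.
move: c r1 r2 t E1 E2 Z1 Z2.
cofix CIH => c r1 r2 t E1 E2 Z1 Z2 hE1 hE2 LZ1 LZ2 eZ1 eZ2.
case: LZ1 => s1 D1 hD1 eD1 L1; case: LZ2 => s2 D2 hD2 eD2 L2.
case: (horseshoe c r1 r2 t s1 s2 E1 E2 D1 D2 hE1 hE2 hD1 hD2).
- by move=> a; rewrite -eZ1.
- by move=> b; rewrite -eZ2.
move=> th [h1 h2 h3 h4 h5].
apply: (LinearSyz _ _ _ (col_mx (row_mx D1 0) (row_mx th D2)) _ h3).
  by move=> k l m; rewrite mxE; case: split => k'; [apply: h1 | apply: h2].
exact: (CIH 1%N _ _ _ _ _ _ _ h1 h2 L1 L2 h4 h5).
Qed.

Lemma linear_syz_rank0 (Z : 'rV[A]_0 -> Prop) : Z 0 -> linear_syz Z.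
Proof.
move: Z; cofix CIH => Z Z0; apply: (LinearSyz _ _ 0%N 0).
- exact: supp_in0.
- move=> v; split=> _; last by rewrite (thinmx0 v).
  by exists 0; rewrite mul0mx (thinmx0 v).
- by apply: CIH; rewrite mul0mx.
Qed.

(* The monomial ideal with set of monomials [U] has a c-linear resolution. *)
Definition linear_res c U := exists s (D : 'M[A]_(s, 1)),
  [/\ supp_in (fun m => mdeg m = c) D,
      forall v : 'rV_1, supp_in U v <-> exists w, w *m D = v
    & linear_syz (fun w => w *m D = 0)].

Lemma linear_res_ext {c U U'} :
  (forall m, U m <-> U' m) -> linear_res c U -> linear_res c U'.
Proof.
move=> UU' [s [D [hD eD L]]]; exists s, D; split=> // v; rewrite -eD.
by split; apply: supp_in_sub => m /UU'.
Qed.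

Lemma linear_res0 c : linear_res c (fun _ => False).
Proof.
exists 0%N, 0; split; first exact: supp_in0.
- move=> v; split=> [/(supp_in_False (fun m F => F)) ->|[w <-]].
    by exists 0; rewrite mul0mx.
  by rewrite mulmx0; apply: supp_in0.
- by apply: linear_syz_rank0; rewrite mul0mx.
Qed.

(** The syzygies of the enlarged generating set project, on the coordinate of [u], onto the colon
    ideal of [U] by [u], with kernel the old syzygies; both ends are linear. *)
Lemma linear_res_add c U u : mdeg u = c -> linear_res c U ->
  linear_res 1 (fun m => U (u + m)%MM) ->
  linear_res c (fun m => U m \/ (u <= m)%MM).
Proof.
move=> du [s [D [hD eD L]]] [s' [D' [hD' eD' L']]].
pose Xu : 'M[A]_1 := ('X_[u])%:M.
have Xu_mul (b : 'rV[A]_1) : b *m Xu = 'X_[u] *: b by rewrite mul_mx_scalar.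
have hXu : supp_in (fun m => mdeg m = c) Xu.
  move=> i j m; rewrite !ord1 mxE eqxx mulr1n mcoeffX.
  by case: (u =P m) => [<-|]; rewrite ?mulr0n ?eqxx.
exists (s + 1)%N, (col_mx D Xu); split.
- by move=> i j m; rewrite mxE; case: split => k; [apply: hD | apply: hXu].
- pose im (v : 'rV_1) := exists w, w *m col_mx D Xu = v.
  have imD v1 v2 : im v1 -> im v2 -> im (v1 + v2).
    by move=> [w1 <-] [w2 <-]; exists (w1 + w2); rewrite mulmxDl.
  move=> v; split=> [hv|[w <-]].
    have -> : v = (v 0 0)%:M by rewrite -mx11_scalar.
    rewrite [v 0 0]mpolyE big_seq raddf_sum /=; apply: (big_ind im) => [||m].
      by exists 0; rewrite mul0mx.
      exact: imD.
    rewrite mcoeff_msupp => nz; have [Um|um] := hv _ _ _ nz.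
      have [|w hw] := (eD ((v 0 0)@_m *: 'X_[m])%:M).1.
        move=> i j m'; rewrite !ord1 mxE eqxx mulr1n mcoeffZ mcoeffX.
        by case: (m =P m') => [<-|]; rewrite ?mulr0n ?mulr0 ?eqxx.
      by exists (row_mx w 0); rewrite mul_row_col mul0mx addr0.
    exists (row_mx 0 ((v 0 0)@_m *: 'X_[m - u])%:M).
    rewrite mul_row_col mul0mx add0r -scalar_mxM -scalerAl -mpolyXD submK //.
  rewrite -[w]hsubmxK mul_row_col Xu_mul; apply: supp_inD.
    by apply: (supp_in_sub (U := U)) => [m|]; [left | apply/eD; exists (lsubmx w)].
  move=> i j m; rewrite mxE => /mcoeffM_neq0[m1 [m2 [+ _ ->]]].
  rewrite mcoeffX; case: (u =P m1) => [<- _|]; rewrite ?mulr0n ?eqxx //.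
  by right; apply: lem_addr.
- have L2 : linear_syz (fun b : 'rV[A]_1 => supp_in (fun m => U (u + m)%MM) b).
    exact: LinearSyz hD' eD' L'.
  apply: (linear_syz_ker_col_mx c _ _ _ _ _ _ _ hD hXu L L2) => // b.
  have -> : (exists a, a *m D + b *m Xu = 0) <-> supp_in U (b *m Xu).
    split=> [[a /eqP]|/supp_inN/eD[a ha]]; last first.
      by exists a; rewrite ha addNr.
    rewrite addrC addr_eq0 => /eqP ->; apply/supp_inN/eD; by exists a.
  rewrite Xu_mul; split=> h i j m; last first.
    by rewrite -(mcoeffXM _ u) => nz; apply: (h i j); rewrite mxE.
  rewrite mxE => /mcoeffM_neq0[m1 [m2 [+ /h nz ->]]].
  by rewrite mcoeffX; case: (u =P m1) => [<- _|]; rewrite ?mulr0n ?eqxx.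
Qed.

(** The variables are added one at a time: the colon of an ideal of variables by a further variable
    is the ideal itself. *)
Lemma linear_res_vars (S : 'I_n -> Prop) :
  linear_res 1 (fun m => exists2 j, S j & (0 < m j)%N).
Proof.
suff h s : uniq s ->
    linear_res 1 (fun m => exists2 j, j \in s /\ S j & (0 < m j)%N).
  apply: linear_res_ext (h _ (enum_uniq 'I_n)) => m.
  by split=> [[j [_ Sj] mj]|[j Sj mj]]; exists j; rewrite ?mem_enum.
elim: s => [_|i s IH /= /andP[si /IH L]].
  by apply: linear_res_ext (linear_res0 1) => m; split=> [//|[j []]].
have [Si|nSi] := classic (S i); last first.
  apply: linear_res_ext L => m; split=> -[j [js Sj] mj]; exists j => //.
    by rewrite inE js orbT.
  by move: js Sj; rewrite inE => /orP[/eqP->|].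
have L' : linear_res 1
    (fun m => exists2 j, j \in s /\ S j & (0 < (U_(i) + m)%MM j)%N).
  apply: linear_res_ext L => m; split=> -[j [js Sj] mj]; exists j => //.
    by rewrite mnmDE addn_gt0 mj orbT.
  move: mj; rewrite mnmDE mnm1E; case: eqP si => [->|//]; by rewrite js.
apply: linear_res_ext (linear_res_add _ _ _ (mdeg1 i) L L') => m.
rewrite lep1mP -lt0n; split=> [[[j [js Sj] mj]|mi]|[j []]].
- by exists j; rewrite // inE js orbT.
- by exists i; rewrite // inE eqxx.
- rewrite inE => /orP[/eqP->|js] Sj mj; [by right | by left; exists j].
Qed.

(* In increasing order, the generators have linear quotients: if [g < u] have
   the same degree then [g] has a smaller exponent at the first place i where
   they differ, so that exchanging x_i in [u] produces a smaller generator. *)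
Lemma linear_res_exchange (e : nat) (G : 'X_{1..n} -> Prop) :
  (forall u, G u -> mdeg u = e) ->
  (forall u v, G u -> G v -> forall i : 'I_n, (v i < u i)%N ->
    exists j : 'I_n, (u j < v j)%N /\ G (u - U_(i) + U_(j))%MM) ->
  linear_res e (fun m => exists2 u, G u & (u <= m)%MM).
Proof.
move=> dG exG.
(* All monomials of degree at most [e] are listed, as [G] need not be decidable; the induction along
   the list passes over those outside [G]. *)
pose L := sort <=%O (undup [seq bmnm b | b : 'X_{1..n < e.+1}]).
have L_sorted : sorted <%O L by rewrite sort_lt_sorted undup_uniq.
have memL g : G g -> g \in L.
  move=> Gg; rewrite mem_sort mem_undup; apply/mapP.
  have lt_g : (mdeg g < e.+1)%N by rewrite dG.
  by exists (BMultinom lt_g); rewrite ?mem_enum.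
suff h s t : s ++ t = L ->
    linear_res e (fun m => exists2 u, G u /\ u \in s & (u <= m)%MM).
  apply: linear_res_ext (h L [::] (cats0 _)) => m.
  by split=> [[g [Gg _] gm]|[g Gg gm]]; exists g => //; split=> //; apply: memL.
elim/last_ind: s t => [t _|s u IH t eL].
  by apply: linear_res_ext (linear_res0 e) => m; split=> [//|[g []]].
have Ls := IH (u :: t); rewrite -cat_rcons in Ls; have {}Ls := Ls eL.
have [Gu|nGu] := classic (G u); last first.
  apply: linear_res_ext Ls => m; split=> -[g [Gg gs] gm]; exists g => //.
    by rewrite mem_rcons inE gs orbT.
  by move: gs Gg; rewrite mem_rcons inE => /orP[/eqP->|].
have ltu g : G g -> g \in s <-> (g < u)%O.
  move: L_sorted; rewrite sorted_pairwise; last exact: lt_trans.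
  rewrite -eL pairwise_cat pairwise_rcons => /and3P[/allrelP h1 /andP[/allP h2 _] _].
  move=> /memL; rewrite -eL mem_cat mem_rcons inE -orbA => gL.
  split=> [/h2//|gu]; case/or3P: gL => [/eqP e1|//|gt].
    by rewrite e1 ltxx in gu.
  have := h1 u g; rewrite mem_rcons inE eqxx => /(_ isT gt) ug.
  by have := lt_trans gu ug; rewrite ltxx.
pose Us m := exists2 g, G g /\ g \in s & (g <= m)%MM.
have colon : linear_res 1 (fun m => Us (u + m)%MM).
  (* The colon by [u] is generated by the variables [x_j] with [x_j u] in [Us]. If [g] divides
     [u m], the exchange gives [j] with [u j < g j], so that [x_j] divides [m]. *)
  apply: linear_res_ext (linear_res_vars (fun j => Us (u + U_(j))%MM)) => m.
  split=> [[j [g Gg gu] mj]|[g [Gg gs] gum]].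
    exists g => //; apply: lepm_trans gu _; apply/mnm_lepP => k.
    rewrite !mnmDE leq_add2l mnm1E; case: eqP => // <-; exact: mj.
  have /ltmcP : (g < u)%O by apply/ltu.
  rewrite !dG // => /(_ erefl)[i gi lti].
  have [j [ltj Gj]] := exG u g Gu Gg i lti.
  exists j; last first.
    have /mnm_lepP/(_ j) := gum; rewrite mnmDE => h.
    by rewrite lt0n; apply: contraTneq ltj => mj; rewrite -leqNgt -[u j]addn0 -mj.
  exists (u - U_(i) + U_(j))%MM; last first.
    by apply/mnm_lepP => k; rewrite !mnmDE mnmBE leq_add2r leq_subr.
  split=> //; apply/ltu => //; apply/ltmcP; first by rewrite !dG.
  (* Before [i] the exponents of [u] and [g] agree, and at [i] that of [g] is smaller, so
     [u j < g j] leaves only [j] beyond [i]. The exchanged monomial thus first differs from [u] at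
     [i], where it is smaller. *)
  have ij : (i < j)%N.
    rewrite ltn_neqAle; apply/andP; split.
      by apply: contraTneq ltj => /val_inj <-; rewrite -leqNgt ltnW.
    by rewrite leqNgt; apply: contraTN ltj => /gi ->; rewrite ltnn.
  exists i => [k ki|]; rewrite mnmDE mnmBE !mnm1E.
    by rewrite -!val_eqE /= (gtn_eqF ki) (gtn_eqF (ltn_trans ki ij)) subn0 addn0.
  rewrite eqxx -[j == i]val_eqE (gtn_eqF ij) addn0 subn1 prednK //.
  exact: leq_ltn_trans lti.
apply: linear_res_ext (linear_res_add _ _ _ (dG u Gu) Ls colon) => m.
split=> [[[g [Gg gs] gm]|um]|[g [Gg]]].
- by exists g; rewrite // mem_rcons inE gs orbT.
- by exists u; rewrite // mem_rcons inE eqxx.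
- by rewrite mem_rcons inE => /orP[/eqP->|gs] gm; [right | left; exists g].
Qed.

(** The rank changes from stage to stage, so it is bundled with the syzygy module; iterated choice
    can then turn the coinductive proof into a sequence of matrices. *)
Record syz_stage := SyzStage {
  stage_rank : nat;
  stage_syz : 'rV[A]_stage_rank -> Prop;
  stage_linear : linear_syz stage_syz
}.

Definition stage_step (S : syz_stage)
    (x : {S' : syz_stage & 'M[A]_(stage_rank S', stage_rank S)}) : Prop :=
  [/\ supp_in (fun m => mdeg m = 1%N) (tagged x),
      forall v, stage_syz S v <-> exists w, w *m tagged x = v
    & forall w, stage_syz (tag x) w <-> w *m tagged x = 0].

Lemma stage_stepP S : exists x, stage_step S x.
Proof.
case: S => r Z [s D hD eD L].
by exists (@Tagged syz_stage (SyzStage s _ L)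
  (fun S' => 'M[A]_(stage_rank S', r)) D).
Qed.

Lemma linear_res_resolution (e : nat) U (I : A -> Prop) :
  linear_res e U -> (forall p, I p <-> forall m, p@_m != 0 -> U m) ->
  generated_in_degree I e -> has_linear_resolution I.
Proof.
case=> s [D [hD eD L]] eI I_deg; exists e; split=> //.
pose next S := constructive_indefinite_description _ (stage_stepP S).
pose st i := iter i (fun S => tag (sval (next S))) (SyzStage s _ L).
pose df i : 'M[A]_(stage_rank (st i.+1), stage_rank (st i)) :=
  tagged (sval (next (st i))).
have stepP i : stage_step (st i) (sval (next (st i))) := svalP (next (st i)).
have df1 i k l m : m \in msupp (df i k l) -> mdeg m = 1%N.
  by rewrite mcoeff_msupp; have [h _ _] := stepP i; apply: h.
have aug_h k m : m \in msupp (D k 0) -> mdeg m = (e + 0)%N.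
  by rewrite mcoeff_msupp addn0 => /hD.
have dif_h i k l m : m \in msupp (df i k l) -> (mdeg m + (e + i) = e + i.+1)%N.
  by move/df1 ->; rewrite add1n addnS.
exists (@GradedFreeSystem K n (fun i => stage_rank (st i)) (fun i _ => (e + i)%N)
  D df aug_h dif_h); split=> //=; last first.
  move=> i k l; apply/eqP; rewrite mcoeff_eq0; apply/negP => /df1.
  by rewrite mdeg0.
split=> /= [p|v|i v].
- have -> : I p <-> supp_in U (p%:M : 'rV_1).
    rewrite eI; split=> [h i j m|h m].
      by rewrite !ord1 mxE eqxx mulr1n; apply: h.
    by have := h 0 0 m; rewrite mxE eqxx mulr1n.
  rewrite eD; split=> -[w hw]; exists w; first by rewrite hw mxE eqxx mulr1n.
  by apply/matrixP => i j; rewrite !ord1 hw mxE eqxx mulr1n.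
- by have [_ h _] := stepP 0%N; rewrite -h.
- have [_ _ h1] := stepP i; have [_ h2 _] := stepP i.+1.
  by rewrite -h2; split=> [/h1|/h1].
Qed.

End LinearSyzygies.

(** * Localizations of polymatroidal ideals are polymatroidal *)

Lemma exists_min {T : Type} (Q : T -> Prop) (g : T -> nat) :
  (exists x, Q x) -> exists2 x, Q x & forall y, Q y -> (g x <= g y)%N.
Proof.
case=> x; have [k] := ubnP (g x); elim: k x => // k IH x; rewrite ltnS => gx Qx.
have [[y [Qy ltyx]]|nex] := classic (exists y, Q y /\ (g y < g x)%N).
  by apply: IH Qy; apply: leq_trans gx.
exists x => // y Qy; rewrite leqNgt; apply/negP => ltyx.
by apply: nex; exists y.
Qed.

Section PolymatroidalLocalizations.

Context {K : fieldType} {n : nat} {I : {mpoly K[n]} -> Prop}.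
Implicit Types (u v w : 'X_{1..n}).

Hypothesis I_poly : polymatroidal I.

(** An exchange preserves the degree, and a monomial of [I] in the generating degree is a minimal
    generator. *)
Lemma mingens_exchange u v (i : 'I_n) : mingens I u -> mingens I v ->
  (v i < u i)%N ->
  exists j : 'I_n, (u j < v j)%N /\ mingens I (u - U_(i) + U_(j))%MM.
Proof.
have [I_mon [d I_deg] ex] := I_poly => Gu Gv ltvu.
have [j [ltuv Ij]] := ex u v Gu Gv i ltvu; exists j; split=> //.
apply: (mingens_of_mdeg I_mon d) => //.
have le1u : (U_(i) <= u)%MM by rewrite lep1mP -lt0n (leq_ltn_trans _ ltvu).
have := mdegD (u - U_(i))%MM U_(i)%MM; rewrite submK // (I_deg.2 u Gu) => ->.
by rewrite mdegD !mdeg1.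
Qed.

(** The minimal generators of the localization are restrictions of generators of [I] of least degree
    on [P]. Exchanging an index of [P] in such a generator brings in an index of [P] again, as
    otherwise the degree on [P] would drop. *)
Lemma localize_polymatroidal (P : {set 'I_n}) :
  exists e, generated_in_degree (localize P I) e /\
    forall a b, mingens (localize P I) a -> mingens (localize P I) b ->
    forall i, (b i < a i)%N ->
    exists j, (a j < b j)%N /\ mingens (localize P I) (a - U_(i) + U_(j))%MM.
Proof.
have [I_mon [d [[u0 Gu0] Gd]] _] := I_poly.
have J_mon := localize_monomial P I_mon.
have [w0 Gw0 w0min] := exists_min (mingens I) (degon P) (ex_intro _ u0 Gu0).
set e := degon P w0 in w0min.
have le1 u v (i : 'I_n) : (v i < u i)%N -> (U_(i) <= u)%MM.
  by move=> lt; rewrite lep1mP -lt0n (leq_ltn_trans _ lt).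
have degon_exch u (i j : 'I_n) : (U_(i) <= u)%MM -> i \in P ->
    (degon P (u - U_(i) + U_(j))%MM).+1 = (degon P u + (j \in P))%N.
  move=> le1u iP; rewrite degonD degonU.
  have := degonD P (u - U_(i))%MM U_(i)%MM; rewrite submK // degonU iP => ->.
  by rewrite -addSn addn1.
(* Exchanging g towards u at an excess variable cannot leave P, as g has least
   degree on P, so that it reduces the excess of g over u on P. *)
have below u : mingens I u -> exists g, [/\ mingens I g, degon P g = e &
    forall i, i \in P -> (g i <= u i)%N].
  move=> Gu; pose Q g := mingens I g /\ degon P g = e.
  have [|g [Gg dg] gmin] := exists_min Q (fun g => \sum_(i in P) (g i - u i))%N.
    by exists w0.
  exists g; split=> // i iP; rewrite leqNgt; apply/negP => ltug.
  have [j [ltgu Gg']] := mingens_exchange g u i Gg Gu ltug.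
  have := degon_exch g i j (le1 _ _ _ ltug) iP.
  case: (boolP (j \in P)) => jP; rewrite dg ?addn1 ?addn0 => dg'; last first.
    by have := w0min _ Gg'; rewrite -dg' ltnn.
  case: dg' => dg'.
  (* The truncated difference drops by one at [i] and stays 0 at [j], where [g j < u j]. *)
  have := gmin _ (conj Gg' dg'); apply/negP; rewrite -ltnNge.
  rewrite (bigD1 i) //= [X in (_ < X)%N](bigD1 i) //=.
  have ij : i != j by apply: contraTneq ltgu => <-; rewrite -leqNgt ltnW.
  rewrite -addSn leq_add //.
    by rewrite mnmDE mnmBE !mnm1E eqxx eq_sym (negbTE ij) addn0; lia.
  apply: leq_sum => k /andP[_ ki].
  rewrite mnmDE mnmBE !mnm1E [i == k]eq_sym (negbTE ki).
  by case: eqP => [<-|_]; lia.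
have J_gen q : mingens (localize P I) q ->
    exists g, [/\ mingens I g, degon P g = e & q = restr P g].
  move=> [/(localizeXP I_mon)[w Iw ->] qmin].
  have [u Gu uw] := mem_mingens_le I_mon Iw.
  have [g [Gg dg gu]] := below u Gu; exists g; split=> //.
  apply/esym/qmin; first by apply/localizeXP => //; exists g => //; case: Gg.
  apply/le_restrP => i iP; apply: leq_trans (gu i iP) _; exact/mnm_lepP.
have J_deg : generated_in_degree (localize P I) e.
  split=> [|q /J_gen[g [_ <- ->]]]; last exact: mdeg_restr.
  have [|q Gq _] := mem_mingens_le J_mon (m := restr P w0); last by exists q.
  by apply/localizeXP => //; exists w0 => //; case: Gw0.
exists e; split=> // a b /J_gen[u [Gu du ->]] /J_gen[v [Gv dv ->]] i.
rewrite !mnmE => ltvu.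
have [j [ltuv Gu']] := mingens_exchange u v _ Gu Gv ltvu.
have := degon_exch u _ j (le1 _ _ _ ltvu) (enum_valP i).
case: (boolP (j \in P)) => jP; rewrite du ?addn1 ?addn0 => du'; last first.
  by have := w0min _ Gu'; rewrite -du' ltnn.
case: du' => du'.
exists (enum_rank_in jP j); rewrite !mnmE enum_rankK_in //; split=> //.
have -> : (restr P u - U_(i) + U_(enum_rank_in jP j))%MM =
    restr P (u - U_(enum_val i) + U_(j))%MM.
  apply/mnmP => k; rewrite !(mnmDE, mnmBE, mnm1E, mnmE).
  rewrite (inj_eq enum_val_inj); congr (_ + nat_of_bool _)%N.
  by rewrite -[in LHS](inj_eq enum_val_inj) enum_rankK_in.
apply: (mingens_of_mdeg J_mon e) => //; last by rewrite mdeg_restr.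
by apply/localizeXP => //; eexists; [case: Gu' => h _; exact: h|].
Qed.

End PolymatroidalLocalizations.

(** * Polymatroidality implies linear localizations, and the equivalence *)

Lemma linear_of_polymatroidal {K : fieldType} {n : nat}
    (I : {mpoly K[n]} -> Prop) (P : {set 'I_n}) :
  polymatroidal I -> has_linear_resolution (localize P I).
Proof.
move=> I_poly; have [I_mon _ _] := I_poly.
have J_mon := localize_monomial P I_mon.
have [e [J_deg ex]] := localize_polymatroidal I_poly P.
have L := linear_res_exchange (K := K) e _ J_deg.2 ex.
apply: linear_res_resolution L _ J_deg => p.
rewrite (mem_monomialP J_mon); split=> h m /h; first exact: mem_mingens_le.
by case=> u [Ju _]; apply: monomial_up.
Qed.

Theorem theorem1p20 (K : fieldType) (n d : nat) (I : {mpoly K[n]} -> Prop)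
    (n_ge3 : (3 <= n)%N)
    (I_mon : monomial_ideal I)
    (I_deg : generated_in_degree I d)
    (V : {set 'I_n})
    (V_card : #|V| = (n - 3)%N)
    (I_pow : forall i : 'I_n, i \in V -> I ('X_i ^+ d)) :
  polymatroidal I <->
  forall P : {set 'I_n}, has_linear_resolution (localize P I).
Proof.
split=> [I_poly P|]; first exact: linear_of_polymatroidal.
exact: polymatroidal_of_linear I_deg.
Qed.
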